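(* Let $X$ be a topological space and $\mathcal F$ a family of subsets of $X$. For every cardinal $\delta$, let $X^\delta$ be the $\delta$-th power of $X$ endowed with the Tychonoff topology, and let $\mathcal F^\delta$ be the family of all products of $\delta$ members of $\mathcal F$ (that is, all sets $\prod_{\beta\in\delta}F_\beta$ with each $F_\beta\in\mathcal F$). Then, for every infinite cardinal $\lambda$, the following are equivalent. (1) There exists some ultrafilter $D$ uniform over $\lambda$ such that $X$ is $\mathcal F$-$D$-compact. (2) There exists some ultrafilter $D$ uniform over $\lambda$ such that, for every cardinal $\delta$, the space $X^\delta$ is $\mathcal F^\delta$-$D$-compact. (3) $X^\delta$ satisfies $\mathcal F^\delta$-$\mathrm{CAP}^*_\lambda$ for every cardinal $\delta$ (if $\lambda$ is regular, then all the equivalent conditions (a)–(f) listed in the context hold for $Y=X^\delta$ and $\mathcal G=\mathcal F^\delta$). (4) $X^\delta$ satisfies $\mathcal F^\delta$-$\mathrm{CAP}^*_\lambda$ for $\delta=\min\{2^{2^\lambda},|\mathcal F|^\lambda\}$ (if $\lambda$ is regular, then all the equivalent conditions (a)–(f) listed in the context hold for $Y=X^\delta$ and $\mathcal G=\mathcal F^\delta$).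
   Context: No separation axioms are assumed. An ultrafilter $D$ over an infinite cardinal $\lambda$ is uniform if every member of $D$ has cardinality $\lambda$. Let $Y$ be a topological space, $\mathcal G$ a family of subsets of $Y$, and $(Y_\alpha)_{\alpha\in\lambda}$ a sequence of subsets of $Y$ (repetitions allowed). A point $y\in Y$ is a $\lambda$-complete accumulation point of the sequence if $|\{\alpha\in\lambda\mid Y_\alpha\cap U\neq\emptyset\}|=\lambda$ for every neighborhood $U$ of $y$. For $D$ an ultrafilter over $\lambda$, $y$ is a $D$-limit point of the sequence if $\{\alpha\in\lambda\mid Y_\alpha\cap U\ne\emptyset\}\in D$ for every neighborhood $U$ of $y$. $Y$ is $\mathcal G$-$D$-compact if every sequence $(G_\alpha)_{\alpha\in\lambda}$ of members of $\mathcal G$ has some $D$-limit point in $Y$. $Y$ satisfies $\mathcal G$-$\mathrm{CAP}^*_\lambda$ if every sequence $(G_\alpha)_{\alpha\in\lambda}$ of members of $\mathcal G$ has a $\lambda$-complete accumulation point in $Y$. The conditions (a)–(f) for a space $Y$, a family $\mathcal G$ of subsets of $Y$ and a regular cardinal $\lambda$ (they are equivalent to each other): (a) For every family $(C_\alpha)_{\alpha\in\lambda}$ of closed sets of $Y$, if for every $Z\subseteq\lambda$ with $|Z|<\lambda$ there exists $G\in\mathcal G$ with $\bigcap_{\alpha\in Z}C_\alpha\supseteq G$, then $\bigcap_{\alpha\in\lambda}C_\alpha\neq\emptyset$ (the intersection over $Z=\emptyset$ is $Y$). (b) Whenever $(C_\alpha)_{\alpha\in\lambda}$ is a family of closed sets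 of $Y$ with $C_\alpha\supseteq C_\beta$ for $\alpha\le\beta<\lambda$ and each $C_\alpha$ contains some $G\in\mathcal G$, then $\bigcap_{\alpha\in\lambda}C_\alpha\neq\emptyset$. (b$_1$) The same as (b), restricted to families in which each $C_\alpha$ is the closure of the union of some set of members of $\mathcal G$. (b$_2$) The same as (b), restricted to families in which each $C_\alpha$ is the closure of the union of some set of at most $\lambda$ members of $\mathcal G$. (c) $Y$ satisfies $\mathcal G$-$\mathrm{CAP}^*_\lambda$. (d) For every sequence $(G_\alpha)_{\alpha\in\lambda}$ of elements of $\mathcal G$ there is an ultrafilter $D$ uniform over $\lambda$ such that the sequence has a $D$-limit point in $Y$. (e) For every open cover $(O_\alpha)_{\alpha\in\lambda}$ of $Y$ there is $Z\subseteq\lambda$ with $|Z|<\lambda$ such that $G\cap\bigcup_{\alpha\in Z}O_\alpha\neq\emptyset$ for every $G\in\mathcal G$. (f) For every open cover $(O_\alpha)_{\alpha\in\lambda}$ of $Y$ with $O_\alpha\subseteq O_\beta$ for $\alpha\le\beta<\lambda$, there is $\alpha\in\lambda$ such that $O_\alpha$ intersects each $G\in\mathcal G$. *)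

(* Defs.v *)
From HB Require Import structures.
From mathcomp Require Import all_boot all_order wochoice all_classical.
From mathcomp Require Import topology.

Set Implicit Arguments.
Unset Strict Implicit.
Unset Printing Implicit Defensive.

Local Open Scope order_scope.
Local Open Scope classical_set_scope.
Local Open Scope card_scope.

Definition card_lt (T U : Type) (A : set T) (B : set U) : Prop :=
  A #<= B /\ ~ (B #<= A).

(* An infinite cardinal is represented by its initial ordinal: an infinite
   well-ordered type all of whose proper initial segments are smaller. *)
Definition infinite_cardinal (d : Order.disp_t) (L : orderType d) : Prop :=
  [/\ infinite_set [set: L],
      well_order (<=%O : rel L) &
      forall a : L, card_lt [set b : L | b < a] [set: L]].

(* To be used for infinite cardinals only. *)
Definition regular_cardinal (d : Order.disp_t) (L : orderType d) : Prop :=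
  forall Z : set L,
    (forall a : L, exists2 b : L, Z b & a <= b) -> Z #= [set: L].

(* 2 ^ (2 ^ L) is [set (set L)] and |F| ^ L is [L -> F]. *)
Definition cardinal_min (A B : Type) : Type :=
  if [set: A] #<= [set: B] then A else B.

Definition uniform_ultrafilter (L : Type) (D : set_system L) : Prop :=
  UltraFilter D /\ forall A : set L, D A -> A #= [set: L].

Definition complete_accumulation_point (L : Type) (Y : topologicalType)
    (S : L -> set Y) (y : Y) : Prop :=
  forall U : set Y, nbhs y U ->
    [set a : L | S a `&` U !=set0] #= [set: L].

Definition D_limit_point (L : Type) (D : set_system L) (Y : topologicalType)
    (S : L -> set Y) (y : Y) : Prop :=
  forall U : set Y, nbhs y U -> D [set a : L | S a `&` U !=set0].

Definition D_compact (L : Type) (D : set_system L) (Y : topologicalType)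
    (G : set (set Y)) : Prop :=
  forall S : L -> set Y, (forall a : L, G (S a)) ->
    exists y : Y, D_limit_point D S y.

Definition CAP_star (L : Type) (Y : topologicalType) (G : set (set Y)) : Prop :=
  forall S : L -> set Y, (forall a : L, G (S a)) ->
    exists y : Y, complete_accumulation_point S y.

Definition cond_a (L : Type) (Y : topologicalType) (G : set (set Y)) : Prop :=
  forall C : L -> set Y, (forall a : L, closed (C a)) ->
    (forall Z : set L, card_lt Z [set: L] ->
       exists2 S : set Y, G S & S `<=` \bigcap_(a in Z) C a) ->
    \bigcap_(a in [set: L]) C a !=set0.

(* [P] restricts the nested families of closed sets under consideration. *)
Definition cond_b_in (d : Order.disp_t) (L : orderType d) (Y : topologicalType)
    (P G : set (set Y)) : Prop :=
  forall C : L -> set Y, (forall a : L, closed (C a)) ->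
    (forall a : L, P (C a)) ->
    (forall a b : L, a <= b -> C b `<=` C a) ->
    (forall a : L, exists2 S : set Y, G S & S `<=` C a) ->
    \bigcap_(a in [set: L]) C a !=set0.

Definition cond_b (d : Order.disp_t) (L : orderType d) (Y : topologicalType)
    (G : set (set Y)) : Prop :=
  cond_b_in L [set: set Y] G.

Definition cond_b1 (d : Order.disp_t) (L : orderType d) (Y : topologicalType)
    (G : set (set Y)) : Prop :=
  cond_b_in L
    [set C | exists2 H : set (set Y),
       H `<=` G & C = closure (\bigcup_(S in H) S)] G.

Definition cond_b2 (d : Order.disp_t) (L : orderType d) (Y : topologicalType)
    (G : set (set Y)) : Prop :=
  cond_b_in L
    [set C | exists H : set (set Y),
       [/\ H `<=` G, H #<= [set: L] & C = closure (\bigcup_(S in H) S)]] G.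

Definition cond_d (L : Type) (Y : topologicalType) (G : set (set Y)) : Prop :=
  forall S : L -> set Y, (forall a : L, G (S a)) ->
    exists2 D : set_system L, uniform_ultrafilter D &
      exists y : Y, D_limit_point D S y.

Definition open_cover_by (L : Type) (Y : topologicalType) (O : L -> set Y) :
    Prop :=
  (forall a : L, open (O a)) /\ \bigcup_(a in [set: L]) O a = [set: Y].

Definition cond_e (L : Type) (Y : topologicalType) (G : set (set Y)) : Prop :=
  forall O : L -> set Y, open_cover_by O ->
    exists2 Z : set L, card_lt Z [set: L] &
      forall S : set Y, G S -> S `&` \bigcup_(a in Z) O a !=set0.

Definition cond_f (d : Order.disp_t) (L : orderType d) (Y : topologicalType)
    (G : set (set Y)) : Prop :=
  forall O : L -> set Y, open_cover_by O ->
    (forall a b : L, a <= b -> O a `<=` O b) ->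
    exists a : L, forall S : set Y, G S -> O a `&` S !=set0.

Variant condition :=
  CondA | CondB | CondB1 | CondB2 | CondC | CondD | CondE | CondF.

Definition satisfies (d : Order.disp_t) (L : orderType d) (c : condition)
    (Y : topologicalType) (G : set (set Y)) : Prop :=
  match c with
  | CondA => cond_a L G
  | CondB => cond_b L G
  | CondB1 => cond_b1 L G
  | CondB2 => cond_b2 L G
  | CondC => CAP_star L G
  | CondD => cond_d L G
  | CondE => cond_e L G
  | CondF => cond_f L G
  end.

(* Only the cardinality of the exponent matters, so that cardinal exponents
   are arbitrary types. *)
Definition power_space (X : topologicalType) (I : Type) : topologicalType :=
  prod_topology (fun _ : I => X).

Definition power_family (X : topologicalType) (F : set (set X)) (I : Type) :
    set (set (power_space X I)) :=
  [set B | exists2 S : I -> set X, forall i : I, F (S i) &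
     B = [set x | forall i : I, S i (x i)]].

Arguments power_family {X} F I.

(* Main.v *)
(* A complete accumulation point [y] of a sequence [S] of sets gives a family
   of large sets [{a | S a meets U}], [U] a neighborhood of [y], that is directed
   downwards; since the complements of small sets form a filter, this family
   extends to a uniform ultrafilter [D], of which [y] is a limit point.  In a
   power, [D] then witnesses a limit point of every coordinate sequence at once.
   Hence one takes as exponent either the set of all sequences of members of
   [F], or the set of all ultrafilters, with one bad sequence for each
   ultrafilter for which [X] is not compact.  Conversely, [D]-limit points in a
   power are computed coordinatewise. *)

Require Import Defs.
From HB Require Import structures.
From mathcomp Require Import all_boot all_order all_classical.
From mathcomp Require Import topology.
From mathcomp Require Import zify.

Set Implicit Arguments.
Unset Strict Implicit.
Unset Printing Implicit Defensive.

Import Order.TTheory.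
Local Open Scope classical_set_scope.

(** * Comparison and absorption of cardinals *)

Lemma card_le_rel (T U : Type) (A : set T) (B : set U) (R : T -> U -> Prop) :
  (forall x, A x -> exists2 y, B y & R x y) ->
  (forall x x' y, R x y -> R x' y -> x = x') ->
  (A #<= B)%card.
Proof.
move=> Rtot Rinj.
have /choice[f fR] : forall x : A, exists y : B, R (val x) (val y).
  move=> x; have [y By Rxy] := Rtot _ (set_valP x).
  by exists (SigSub (mem_set By)).
apply/card_leP/injfunPex; exists f => // x x' _ _ fxx'.
by apply: val_inj; apply: Rinj (fR x) _; rewrite fxx'.
Qed.

(** Zorn's lemma gives a maximal graph [G] of a partial injection from [A] to [B]. It exhausts one
    of the two sets: otherwise a pair of missed points could be added to it. *)
Lemma card_le_total (T U : Type) (A : set T) (B : set U) :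
  (A #<= B)%card \/ (B #<= A)%card.
Proof.
pose P (G : set (T * U)) := (forall p, G p -> A p.1 /\ B p.2) /\
  forall p q, G p -> G q -> p.1 = q.1 <-> p.2 = q.2.
have [|G [[GAB Ginj] Gmax]] := @Zorn_bigcup (T * U)%type P.
  move=> F FP Ftot; split=> [p [G FG Gp]|p q [G FG Gp] [H FH Hq]].
    by have [+ _] := FP _ FG; apply.
  have [GH|HG] := Ftot _ _ FG FH.
    by have [_] := FP _ FH; apply => //; apply: GH.
  by have [_] := FP _ FG; apply => //; apply: HG.
have [Gtot|/existsNP[x0 /not_implyP[Ax0 Gx0]]] :=
    pselect (forall x, A x -> exists2 y, B y & G (x, y)).
  by left; apply: card_le_rel Gtot _ => x x' y Gx Gx'; apply/(Ginj _ _ Gx Gx').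
right; apply: (@card_le_rel _ _ _ _ (fun y x => G (x, y))); last first.
  by move=> y y' x Gy Gy'; apply/(Ginj _ _ Gy Gy').
move=> y By; apply: contrapT => Gy.
have GNx y' : ~ G (x0, y')
  by move=> Gxy'; apply: Gx0; exists y' => //; case: (GAB _ Gxy').
have GNy x' : ~ G (x', y)
  by move=> Gxy'; apply: Gy; exists x' => //; case: (GAB _ Gxy').
apply: (Gmax (G `|` [set (x0, y)])).
  by split=> [|/(_ (x0, y) (or_intror erefl)) /GNx//]; left.
split=> [p [/GAB//|->//]|p q [Gp [Gq|->]|-> [Gq|->]]] //.
- exact: Ginj.
- move: p Gp => [x' y'] /= Gxy'; split=> E; subst; exfalso.
    exact: GNx Gxy'.
  exact: GNy Gxy'.
- move: q Gq => [x' y'] /= Gxy'; split=> E; subst; exfalso.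
    exact: GNx Gxy'.
  exact: GNy Gxy'.
Qed.

Lemma card_le_setUr (T : Type) (A B : set T) :
  infinite_set B -> (A #<= B)%card -> (A `|` B #<= B)%card.
Proof.
elim/Ppointed: T => T in A B *.
  by move=> /infinite_setN0[x]; have := no x.
move=> Binf /pcard_leP[g].
pose P (E : set (nat -> T)) := forall f f' m n, E f -> E f' ->
  B (f m) /\ (f m = f' n -> f = f' /\ m = n).
have [|E [PE Emax]] := @Zorn_bigcup (nat -> T) P.
  move=> F FP Ftot f f' m n [G FG Gf] [H FH Hf'].
  have [GH|HG] := Ftot _ _ FG FH.
    by apply: (FP _ FH) => //; apply: GH.
  by apply: (FP _ FG) => //; apply: HG.
pose M := [set x | exists f n, E f /\ f n = x].
(* An infinite remainder would contain the range of one more injective sequence, against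
   maximality. *)
have Rfin : finite_set (B `\` M).
  apply: contrapT => /infiniteP/pcard_leP[h].
  have hB n : B (h n) /\ ~ M (h n) by have := @funS _ _ _ _ h n Logic.I.
  have hinj m n : h m = h n -> m = n by apply: inj; rewrite inE.
  apply: (Emax (E `|` [set (h : nat -> T)])).
    split=> [|/(_ _ (or_intror erefl)) Eh]; first by left.
    by have [_] := hB 0%N; apply; exists h, 0%N.
  move=> f f' m n [Ef|->] [Ef'|->].
  - exact: PE.
  - split=> [|fh]; first by have [] := PE _ _ m m Ef Ef.
    by have [_ []] := hB n; exists f, m.
  - split=> [|fh]; first by have [] := hB m.
    by have [_ []] := hB m; exists f', n.
  - by split=> [|/hinj]; have [] := hB m.
have [f0 Ef0] : E !=set0.
  apply: contrapT => E0; apply: Binf; apply: sub_finite_set Rfin => x Bx.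
  by split=> // -[f [n [Ef _]]]; apply: E0; exists f.
(* [S] collects the exceptional points: those of [B] on no sequence of [E], and those of [A] that
   [g] sends there. Being finite, it is numbered by [e] and fits on the single sequence [f0]. *)
pose S := (B `\` M) `|` (A `&` g @^-1` (B `\` M)).
have /finite_set_countable/countable_injP[e einj] : finite_set S.
  rewrite finite_setU; split=> //.
  apply: card_le_finite Rfin.
  apply/pcard_leP/injfunPex; exists g => [x []//|x y].
  by rewrite !inE => -[Ax _] [Ay _]; apply: inj; rewrite inE.
have PB f n : E f -> B (f n) by move=> Ef; have [] := PE f f n n Ef Ef.
(* [B] contains, up to a finite set, the disjoint ranges of the sequences in
   [E]; the residues modulo 3 make room for three copies of these ranges. *)
pose code x k f n := match k with
  | 0 => f n = x
  | 1 => A x /\ f n = g x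
  | _ => [/\ S x, f = f0 & n = e x] end.
apply: (@card_le_rel _ _ _ _ (fun x y => exists k f n,
    [/\ (k < 3)%N, E f, y = f (n * 3 + k)%N & code x k f n])).
  move=> x ABx; have [Sx|NSx] := pselect (S x).
    by exists (f0 (e x * 3 + 2)%N); [exact: PB|exists 2%N, f0, (e x)].
  case: ABx => [Ax|Bx].
    have [f [n [Ef fx]]] : M (g x).
      apply: contrapT => NMgx; apply: NSx; right.
      by split=> //; split=> //; apply: funS.
    by exists (f (n * 3 + 1)%N); [exact: PB|exists 1%N, f, n].
  have [f [n [Ef fx]]] : M x by apply: contrapT => NMx; apply: NSx; left.
  by exists (f (n * 3 + 0)%N); [exact: PB|exists 0%N, f, n].
move=> x x' y [k [f [n [k3 Ef ->]]]] + [k' [f' [n' [k'3 Ef' ff']]]].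
have [<- nn'] := (PE _ _ _ _ Ef Ef').2 ff'.
have [<- <-] : n = n' /\ k = k' by lia.
case: k k3 {k'3 ff' nn'} => [|[|k]] k3 /=; first by move=> <-.
  by move=> [Ax ->] [Ax'] /inj; apply; rewrite inE.
by move=> [Sx _ ->] [Sx' _] /einj; apply; rewrite inE.
Qed.

(** By comparability [A] may be taken as the smaller set; absorption then reduces the union to [B],
    which is infinite because [C] is. This makes the union of two small sets small. *)
Lemma infinite_card_le_setU (T U : Type) (C : set U) (A B : set T) :
  infinite_set C -> (C #<= A `|` B)%card -> (C #<= A)%card \/ (C #<= B)%card.
Proof.
move=> Cinf; wlog AB : A B / (A #<= B)%card.
  move=> wlg CAB; have [AB|BA] := card_le_total A B; first exact: wlg.
  by rewrite setUC in CAB; have [] := wlg _ _ BA CAB; [right|left].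
move=> CAB; right; apply: card_le_trans (CAB) _; apply: card_le_setUr => // Bfin.
apply: Cinf; apply: card_le_finite CAB _; rewrite finite_setU; split=> //.
exact: card_le_finite AB Bfin.
Qed.

(** * Uniform ultrafilters and limit points *)

Lemma card_eq_setTP (L : Type) (A : set L) :
  (A #= [set: L])%card <-> ([set: L] #<= A)%card.
Proof.
by rewrite card_eq_le card_leT.
Qed.

Lemma card_lt_setTP (L : Type) (A : set L) :
  card_lt A [set: L] <-> ~ (A #= [set: L])%card.
Proof.
split=> [[_ AL] /card_eq_setTP//|AL].
by split=> [|/card_eq_setTP//]; exact: card_leT.
Qed.

Lemma uniform_ultrafilter_extend (L : Type) (B : set_system L) :
  infinite_set [set: L] -> B !=set0 ->
  (forall U V, B U -> B V -> exists2 W, B W & W `<=` U `&` V) ->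
  (forall U, B U -> (U #= [set: L])%card) ->
  exists2 D, uniform_ultrafilter D & B `<=` D.
Proof.
move=> Linf [U0 BU0] BI Blarge.
(* [H] is the filter generated by [B] and the complements of small sets: its members contain some
   [U] in [B] up to a small set. Any ultrafilter above it is uniform. *)
pose H (A : set L) := exists2 U, B U & ~ (U `\` A #= [set: L])%card.
have empty_small : ~ (@set0 L #= [set: L])%card.
  by rewrite card_eq_sym card_eq0 => /eqP L0; apply: Linf; rewrite L0.
have Hproper : ProperFilter H.
  split; first by move=> [U BU]; rewrite setD0 => /(_ (Blarge _ BU)).
  split.
  - by exists U0 => //; rewrite setDT.
  - move=> P Q [U BU UP] [V BV VQ]; have [W BW WUV] := BI _ _ BU BV.
    exists W => // /card_eq_setTP WPQ.
    have WE : W `\` (P `&` Q) `<=` (U `\` P) `|` (V `\` Q).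
      move=> a [/WUV[Ua Va] /not_andP[NPa|NQa]]; [by left|by right].
    have [] := infinite_card_le_setU Linf (card_le_trans WPQ (subset_card_le WE)).
      by move/card_eq_setTP/UP.
    by move/card_eq_setTP/VQ.
  - move=> P Q PQ [U BU UP]; exists U => // /card_eq_setTP UQ.
    apply: UP; apply/card_eq_setTP; apply: card_le_trans UQ _.
    by apply: subset_card_le => a [Ua NQa]; split=> // /PQ.
have [D [Dultra HD]] := ultraFilterLemma Hproper.
exists D; last first.
  by move=> U BU; apply: HD; exists U => //; rewrite setDv.
split=> // A DA; apply: contrapT => Asmall.
have DNA : D (~` A).
  apply: HD; exists U0 => // /card_eq_setTP UA; apply: Asmall.
  apply/card_eq_setTP; apply: card_le_trans UA _; apply: subset_card_le => a [_].
  exact: contrapT.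
by apply: (filter_not_empty D); rewrite -(setICr A); exact: filterI.
Qed.

Lemma complete_accumulation_D_limit (L : Type) (Y : topologicalType)
    (S : L -> set Y) (y : Y) :
  infinite_set [set: L] -> complete_accumulation_point S y ->
  exists2 D : set_system L, uniform_ultrafilter D & D_limit_point D S y.
Proof.
move=> Linf Sy.
pose B := [set [set a | S a `&` U !=set0] | U in nbhs y].
have [|U V [U' nU' <-] [V' nV' <-]|U [U' nU' <-]|D Dunif BD] :=
  @uniform_ultrafilter_extend L B Linf.
- by exists [set a | S a `&` setT !=set0], setT => //; exact: filterT.
- exists [set a | S a `&` (U' `&` V') !=set0].
    by exists (U' `&` V') => //; exact: filterI.
  by move=> a [x [Sx [Ux Vx]]]; split; exists x.
- exact: Sy.
- by exists D => // U nU; apply: BD; exists U.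
Qed.

Lemma D_limit_complete_accumulation (L : Type) (D : set_system L)
    (Y : topologicalType) (S : L -> set Y) (y : Y) :
  uniform_ultrafilter D -> D_limit_point D S y ->
  complete_accumulation_point S y.
Proof. by move=> [_ Dunif] Sy U /Sy/Dunif. Qed.

Lemma D_compact_CAP_star (L : Type) (D : set_system L) (Y : topologicalType)
    (G : set (set Y)) :
  uniform_ultrafilter D -> D_compact D G -> CAP_star L G.
Proof.
move=> Dunif Dcomp S GS; have [y Dy] := Dcomp S GS.
by exists y; exact: D_limit_complete_accumulation Dunif Dy.
Qed.

(** * Limit points in powers *)

Lemma power_space_proj_continuous (X : topologicalType) (I : Type) (i : I)
    (y : power_space X I) (V : set X) :
  nbhs (y i) V -> nbhs y [set x : power_space X I | V (x i)].
Proof.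
move=> nV; have /cvg_sup/(_ i) : nbhs y --> y by exact: cvg_id.
by apply; apply: (@initial_continuous _ _ (fun f : I -> X => f i)).
Qed.

Lemma power_space_nbhs (X : topologicalType) (I : Type)
    (y : power_space X I) (U : set (power_space X I)) :
  nbhs y U -> exists2 V : I -> set X, finite_set [set i | V i != setT] &
    (forall i, nbhs (y i) (V i)) /\ [set x | forall i, V i (x i)] `<=` U.
Proof.
pose H (U : set (power_space X I)) :=
  exists2 V : I -> set X, finite_set [set i | V i != setT] &
    (forall i, nbhs (y i) (V i)) /\ [set x | forall i, V i (x i)] `<=` U.
suff Hy : nbhs y `<=` H by exact: Hy.
have HF : Filter H.
  split.
  - exists (fun=> setT); last by split=> // i; exact: filterT.
    rewrite (_ : mkset _ = set0) ?finite_set0//.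
    by apply/seteqP; split=> // i /=; rewrite eqxx.
  - move=> P Q [V Vfin [Vy VP]] [W Wfin [Wy WQ]]; exists (fun i => V i `&` W i).
      apply: (@sub_finite_set _ _ ([set i | V i != setT] `|` [set i | W i != setT])).
        move=> i /= /eqP VWi; have [Vi|] := eqVneq (V i) setT; last by left.
        by right; apply/eqP => Wi; apply: VWi; rewrite Vi Wi setIT.
      by rewrite finite_setU.
    split=> [i|x VWx]; first exact: filterI.
    by split; [apply: VP|apply: WQ] => i; have [] := VWx i.
  - by move=> P Q PQ [V Vfin [Vy VP]]; exists V => //; split=> // x /VP/PQ.
(* The product topology is the supremum of the initial topologies of the projections, so only
   neighborhoods depending on one coordinate have to be checked. *)
apply/(@cvg_sup _ _ _ H y HF) => i A; rewrite nbhsE => -[_ [[W Wop <-] Wy] WA].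
exists (fun j => if pselect (j = i) then W else setT).
  apply: (@sub_finite_set _ _ [set i]) => [j /=|]; last exact: finite_set1.
  by case: pselect => //= _; rewrite eqxx.
split=> [j|x Vx].
  case: pselect => [/= ->|/= _]; last exact: filterT.
  exact: open_nbhs_nbhs.
by apply: WA => /=; have := Vx i; case: pselect.
Qed.

Lemma filter_bigcap_finite (T I : Type) (A : set I) (f : I -> set T)
    (F : set_system T) :
  Filter F -> finite_set A -> (forall i, A i -> F (f i)) ->
  F (\bigcap_(i in A) f i).
Proof.
elim/Pchoice: I => I in A f * => FF /finite_fsetP[B ->] Ff.
exact: filter_bigI.
Qed.

(** A basic box restricts finitely many coordinates, and [D] is closed under finite intersections.
    In the other coordinates a point is picked from the nonempty [S i a]. *)
Lemma D_limit_power_space (L : Type) (D : set_system L) (X : topologicalType)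
    (I : Type) (S : I -> L -> set X) (y : power_space X I) :
  UltraFilter D -> (forall i a, S i a !=set0) ->
  (forall i, D_limit_point D (S i) (y i)) ->
  D_limit_point D
    (fun a => [set x : power_space X I | forall i, S i a (x i)]) y.
Proof.
move=> Dultra S0 Sy U /power_space_nbhs[V Vfin [Vy VU]].
have DV : D (\bigcap_(i in [set i | V i != setT]) [set a | S i a `&` V i !=set0]).
  by apply: filter_bigcap_finite => // i _; exact: Sy.
apply: filterS DV => a Va.
have /choice[x xP] : forall i, exists x, S i a x /\ V i x.
  move=> i; have [Vi|Vi] := eqVneq (V i) setT; last exact: Va.
  by have [x Sx] := S0 i a; exists x; rewrite Vi.
by exists x; split=> [i|]; [|apply: VU => i]; have [] := xP i.
Qed.

Lemma D_limit_proj (L : Type) (D : set_system L) (X : topologicalType)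
    (I : Type) (S : I -> L -> set X) (y : power_space X I) :
  UltraFilter D ->
  D_limit_point D
    (fun a => [set x : power_space X I | forall i, S i a (x i)]) y ->
  forall i, D_limit_point D (S i) (y i).
Proof.
move=> Dultra Sy i V nV; apply: filterS (Sy _ (power_space_proj_continuous nV)).
by move=> a [x [Sx Vx]]; exists (x i).
Qed.

Lemma D_compact_power (L : Type) (D : set_system L) (X : topologicalType)
    (F : set (set X)) (I : Type) :
  UltraFilter D -> D_compact D F -> D_compact D (power_family F I).
Proof.
move=> Dultra Fcomp G GF.
(* A limit point of the constant sequence [B] forces [B] to meet the whole space. *)
have F0 B : F B -> B !=set0.
  move=> FB; have [y By] := Fcomp (fun=> B) (fun=> FB).
  have [a [x [Bx _]]] := filter_ex (By setT filterT).
  by exists x.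
have /choice[S SP] : forall a, exists S : I -> set X,
    (forall i, F (S i)) /\ G a = [set x | forall i, S i (x i)].
  by move=> a; have [S SF ->] := GF a; exists S.
have /choice[y yP] : forall i, exists y, D_limit_point D (S^~ i) y.
  by move=> i; apply: Fcomp => a; have [] := SP a.
exists y; rewrite (_ : G = fun a => [set x | forall i, S a i (x i)]).
  apply: (@D_limit_power_space _ _ _ _ (fun i a => S a i)) => // i a.
  by apply: F0; have [] := SP a.
by apply/funext => a; have [] := SP a.
Qed.

(** The ultrafilter comes from one accumulation point of the sequence of products, hence is the same
    for all coordinates [i]. *)
Lemma CAP_star_power_D_limit (L : Type) (X : topologicalType) (F : set (set X))
    (I : Type) (S : I -> L -> set X) :
  infinite_set [set: L] -> (forall i a, F (S i a)) ->
  CAP_star L (power_family F I) ->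
  exists2 D : set_system L, uniform_ultrafilter D &
    forall i, exists y, D_limit_point D (S i) y.
Proof.
move=> Linf SF /(_ (fun a => [set x | forall i, S i a (x i)]))[a|y].
  by exists (S^~ a).
move=> /(complete_accumulation_D_limit Linf)[D Dunif Dy].
exists D => // i; exists (y i); apply: D_limit_proj Dy _.
by case: Dunif.
Qed.

Lemma CAP_star_delta_D_compact (L : Type) (X : topologicalType)
    (F : set (set X)) :
  infinite_set [set: L] ->
  CAP_star L (power_family F (cardinal_min (set (set L)) (L -> F))) ->
  exists2 D : set_system L, uniform_ultrafilter D & D_compact D F.
Proof.
move=> Linf; rewrite /cardinal_min; case: ifPn => [seqs|_] CAP; last first.
  (* Here the exponent is [L -> F], and coordinate [s] carries the sequence [s] itself. *)
  have [//|D Dunif Dlim] :=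
      CAP_star_power_D_limit (S := fun s a => val (s a)) Linf _ CAP.
    by move=> s a; exact: set_valP.
  exists D => // S SF.
  by have := Dlim (fun a => SigSub (mem_set (SF a))).
(* The default [s0] serves the coordinates [D] for which no bad sequence exists. *)
have [s0] : [set: L -> F] !=set0.
  apply/set0P/eqP => L0; move: seqs; rewrite L0 card_le0 => /eqP E.
  by have : set0 (set0 : set (set L)) by rewrite -E.
move=> _.
(* Diagonal argument: coordinate [D] carries a sequence without [D]-limit point whenever there is
   one. The ultrafilter obtained from the power is then tested at its own coordinate. *)
have /choice[s sP] : forall D : set_system L, exists s : L -> set X,
    (forall a, F (s a)) /\
    ((exists y, D_limit_point D s y) -> D_compact D F).
  move=> D; have [DF|] := pselect (D_compact D F).
    by exists (fun a => val (s0 a)); split=> // a; exact: set_valP.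
  by move=> /existsNP[s /not_implyP[sF sN]]; exists s.
have [|D Dunif Dlim] := CAP_star_power_D_limit (S := s) Linf _ CAP.
  by move=> D a; have [+ _] := sP D; apply.
by exists D => //; have [_] := sP D; apply.
Qed.

(** * Equivalence of the conditions (a)-(f) for regular cardinals *)

Lemma card_lt_initial (d : Order.disp_t) (L : orderType d) (a : L) :
  infinite_cardinal L -> card_lt [set b : L | (b <= a)%O] [set: L].
Proof.
move=> [Linf _ Lseg]; apply/card_lt_setTP => /card_eq_setTP La.
have sub : [set b : L | (b <= a)%O] `<=` [set b | (b < a)%O] `|` [set a].
  by move=> b /=; rewrite le_eqVlt => /orP[/eqP->|]; [right|left].
have [] := infinite_card_le_setU Linf (card_le_trans La (subset_card_le sub)).
  by case: (Lseg a).
by move=> /card_le_finite/(_ (finite_set1 a)).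
Qed.

Lemma large_set_cofinal (d : Order.disp_t) (L : orderType d) (A : set L) :
  infinite_cardinal L -> (A #= [set: L])%card ->
  forall a, exists2 b, A b & (a < b)%O.
Proof.
move=> hL /card_eq_setTP LA a; apply: contrapT => Aa.
case: (card_lt_initial a hL) => _; apply; apply: card_le_trans LA _.
apply: subset_card_le => b Ab /=; rewrite leNgt; apply/negP => ab.
by apply: Aa; exists b.
Qed.

Lemma regular_small_bounded (d : Order.disp_t) (L : orderType d) (Z : set L) :
  regular_cardinal L -> card_lt Z [set: L] ->
  exists a : L, forall b, Z b -> (b < a)%O.
Proof.
move=> Lreg /card_lt_setTP Zsmall; apply: contrapT => Zunb; apply: Zsmall.
apply: Lreg => a; apply: contrapT => Za; apply: Zunb; exists a => b Zb.
by rewrite ltNge; apply/negP => ab; apply: Za; exists b.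
Qed.

Section EquivalentConditions.
Variables (d : Order.disp_t) (L : orderType d).
Hypothesis hL : infinite_cardinal L.
Variables (Y : topologicalType) (G : set (set Y)).

Lemma CAP_star_cond_a : CAP_star L G -> cond_a L G.
Proof.
move=> CAP C Cclosed CG.
(* Initial segments are small, so each [S a] can be chosen inside all [C b] with [b <= a]. A large
   set of indices is cofinal, so every neighborhood of an accumulation point meets each [C b]. *)
have /choice[S SP] : forall a, exists S, G S /\
    S `<=` \bigcap_(b in [set b | (b <= a)%O]) C b.
  by move=> a; have [S GS SC] := CG _ (card_lt_initial a hL); exists S.
have [|y Sy] := CAP S; first by move=> a; have [] := SP a.
exists y => b _; apply: (Cclosed b) => U /Sy Ularge.
have [a [x [Sx Ux]] ba] := large_set_cofinal hL Ularge b.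
exists x; split=> //; have [_ SC] := SP a.
by apply: SC Sx _ (ltW ba).
Qed.

Lemma cond_a_b : regular_cardinal L -> cond_a L G -> cond_b L G.
Proof.
move=> Lreg a_holds C Cclosed _ Cnested CG; apply: a_holds => // Z Zsmall.
have [a Za] := regular_small_bounded Lreg Zsmall.
have [S GS SC] := CG a; exists S => // x /SC Cx b /Za ba.
exact: Cnested (ltW ba) _ Cx.
Qed.

Lemma cond_b_inS (P Q : set (set Y)) :
  P `<=` Q -> cond_b_in L Q G -> cond_b_in L P G.
Proof. by move=> PQ b_holds C Cclosed PC; apply: b_holds => // a; exact: PQ. Qed.

Lemma cond_b2_CAP_star : regular_cardinal L -> cond_b2 L G -> CAP_star L G.
Proof.
move=> Lreg b_holds S GS.
(* A point common to the closures of all tails has neighborhoods that meet [S b] for cofinally many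
   [b]; regularity makes these indices a large set. *)
pose tail a := [set S b | b in [set b | (a <= b)%O]].
have [|a|a b ab|a|y yP] := b_holds (fun a => closure (\bigcup_(B in tail a) B)).
- by move=> a; exact: closed_closure.
- exists (tail a); split=> //; first by move=> _ [b _ <-].
  by apply: card_le_trans (card_image_le _ _) (card_leT _).
- apply: closureS; apply: bigcup_subset => _ [c bc <-]; exists c => //=.
  exact: le_trans bc.
- exists (S a) => //; apply: subset_trans (@subset_closure _ _) => x Sx.
  by exists (S a) => //; exists a => //=.
exists y => U nU; apply: Lreg => a.
have [x [[B [b ab SbB] Bx] Ux]] := yP a Logic.I _ nU.
by exists b => //; exists x; rewrite SbB.
Qed.

Lemma CAP_star_cond_d : CAP_star L G <-> cond_d L G.
Proof.
split=> CAP S GS.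
  have [y /complete_accumulation_D_limit[]] := CAP S GS.
    by case: hL.
  by move=> D Dunif Dy; exists D => //; exists y.
have [D Dunif [y Dy]] := CAP S GS.
by exists y; exact: D_limit_complete_accumulation Dunif Dy.
Qed.

(* Complementation [C a = ~` O a] exchanges open covers and families of closed
   sets with empty intersection. *)
Lemma cond_a_e : cond_a L G <-> cond_e L G.
Proof.
split=> [a_holds O [Oopen Ocov]|e_holds C Cclosed CG].
  apply: contrapT => NZ.
  have [a|Z Zsmall|y yO] := a_holds (fun a => ~` O a).
  - exact: open_closedC.
  - apply: contrapT => NS; apply: NZ; exists Z => // S GS.
    apply/set0P/negP => /eqP S0; apply: NS; exists S => // x Sx a Za Ox.
    by have : set0 x by rewrite -S0; split=> //; exists a.
  - have : [set: Y] y by [].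
    by rewrite -Ocov => -[a _]; exact: yO.
apply: contrapT => C0.
have [|Z Zsmall ZG] := e_holds (fun a => ~` C a).
  split=> [a|]; first exact: closed_openC.
  apply/seteqP; split=> // y _; apply: contrapT => NC; apply: C0.
  by exists y => a _; apply: contrapT => NCa; apply: NC; exists a.
have [S GS SC] := CG Z Zsmall.
have [x [Sx [a Za]]] := ZG S GS.
by apply; apply: SC.
Qed.

Lemma cond_b_f : cond_b L G <-> cond_f L G.
Proof.
split=> [b_holds O [Oopen Ocov] Onested|f_holds C Cclosed _ Cnested CG].
  apply: contrapT => NZ.
  have [a|//|a b ab|a|y yO] := b_holds (fun a => ~` O a).
  - exact: open_closedC.
  - by apply: subsetC; exact: Onested.
  - apply: contrapT => NS; apply: NZ; exists a => S GS.
    apply/set0P/negP => /eqP S0; apply: NS; exists S => // x Sx Ox.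
    by have : set0 x by rewrite -S0.
  - have : [set: Y] y by [].
    by rewrite -Ocov => -[a _]; exact: yO.
apply: contrapT => C0.
have [|a b ab|a aG] := f_holds (fun a => ~` C a).
- split=> [a|]; first exact: closed_openC.
  apply/seteqP; split=> // y _; apply: contrapT => NC; apply: C0.
  by exists y => a _; apply: contrapT => NCa; apply: NC; exists a.
- by apply: subsetC; exact: Cnested.
have [S GS SC] := CG a.
by have [x [Cx /SC]] := aG S GS.
Qed.

(** The cycle runs from CAP* through (a), (b), (b1), (b2) and back; (d), (e) and (f) are attached to
    CAP*, (a) and (b) respectively. *)
Lemma satisfies_CAP_star (c : condition) :
  regular_cardinal L -> satisfies L c G <-> CAP_star L G.
Proof.
move=> Lreg.
have b_b1 : cond_b L G -> cond_b1 L G by exact: cond_b_inS.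
have b1_b2 : cond_b1 L G -> cond_b2 L G.
  by apply: cond_b_inS => _ [H [HG _ ->]]; exists H.
have := CAP_star_cond_a; have := cond_a_b Lreg; have := cond_b2_CAP_star Lreg.
have := CAP_star_cond_d; have := cond_a_e; have := cond_b_f.
by case: c => /=; tauto.
Qed.

End EquivalentConditions.

(* The second component renders the parenthetical remarks in (3) and (4): for
   regular [L], CAP* may be replaced there by any of the conditions (a)-(f). *)
Theorem theorem5p2 (X : topologicalType) (F : set (set X))
    (d : Order.disp_t) (L : orderType d) (hL : infinite_cardinal L) :
  let delta := cardinal_min (set (set L)) (L -> F) in
  [<-> exists2 D : set_system L, uniform_ultrafilter D & D_compact D F;
       exists2 D : set_system L, uniform_ultrafilter D &
         forall I : Type, D_compact D (power_family F I);
       forall I : Type, CAP_star L (power_family F I);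
       CAP_star L (power_family F delta)]
  /\ (regular_cardinal L -> forall c : condition,
      [<-> exists2 D : set_system L, uniform_ultrafilter D & D_compact D F;
           forall I : Type, satisfies L c (power_family F I);
           satisfies L c (power_family F delta)]).
Proof.
have Linf : infinite_set [set: L] by case: hL.
move=> delta.
split=> [|Lreg c].
  tfae.
  - by move=> [D [Dultra ?] DF]; exists D => // I; exact: D_compact_power.
  - by move=> [D Dunif Dcomp] I; exact: D_compact_CAP_star Dunif (Dcomp I).
  - exact.
  - exact: CAP_star_delta_D_compact.
tfae.
- move=> [D Dunif DF] I; apply/(satisfies_CAP_star hL _ _ Lreg).
  apply: (D_compact_CAP_star Dunif); apply: D_compact_power DF.
  by case: Dunif.
- exact.
- by move=> /(satisfies_CAP_star hL _ _ Lreg); exact: CAP_star_delta_D_compact.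
Qed.
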